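(* For all $n\in\omega$, the partition hypothesis $\mathrm{PH}_n(\omega_n)$ is false.
   Context: For a directed quasi-order $(P,\le)$ and $m\ge1$: $P^{\le m}=\bigcup_{i=1}^mP^i$; for tuples, $\mathbf{x}\trianglelefteq\mathbf{y}$ means $\mathbf{x}$ is obtained from $\mathbf{y}$ by deleting coordinates; $P\langle\langle m\rangle\rangle$ is the set of $\sigma=(\sigma(1),\dots,\sigma(m))$ with $\sigma(i)\in P^i$ and $\sigma(1)\trianglelefteq\cdots\trianglelefteq\sigma(m)$ ($P^1$ identified with $P$). $F:P^{\le m}\to P$ is $m$-cofinal if $x\le F(x)$ for all $x\in P$ and $F(\mathbf{x})\le F(\mathbf{y})$ whenever $\mathbf{x}\trianglelefteq\mathbf{y}$; $F^*(\sigma)=(F(\sigma(1)),\dots,F(\sigma(m)))$. For a cardinal $\lambda$, $\mathrm{PH}_n(P,\lambda)$ states: for every $c:P^{n+1}\to\lambda$ there is an $(n+1)$-cofinal $F:P^{\le n+1}\to P$ with $c\circ F^*$ constant. For an ordinal $\varepsilon$ (ordered by $\le$), $\mathrm{PH}_n(\varepsilon)$ means $\mathrm{PH}_n(\varepsilon,\omega)$. Here $\omega_0=\omega$. *)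

(* Defs.v *)
From HB Require Import structures.
From mathcomp Require Import all_boot all_order.
From mathcomp Require Import boolp classical_sets functions cardinality wochoice.

Set Implicit Arguments.
Unset Strict Implicit.
Unset Printing Implicit Defensive.

Import Order.TTheory.
Local Open Scope classical_set_scope.

(* P^{<= m}, as the disjoint union of the P^{i+1} for i < m. *)
Definition tuples_upto (P : Type) (m : nat) := {i : 'I_m & i.+1.-tuple P}.

Definition upto_seq (P : Type) (m : nat) (u : tuples_upto P m) : seq P :=
  tagged u.

(* The set P<<m>>; coordinates are numbered from 0, so that [sigma i] below is
   the tuple sigma(i+1) of length i+1. *)
Record tuple_chain (P : eqType) (m : nat) := TupleChain {
  chain_fun :> forall i : 'I_m, i.+1.-tuple P;
  chain_subseq : forall i j : 'I_m,
    j = i.+1 :> nat -> subseq (chain_fun i) (chain_fun j)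
}.

Definition star (P : eqType) (m : nat) (F : tuples_upto P m -> P)
    (sigma : tuple_chain P m) : m.-tuple P :=
  [tuple F (Tagged (fun i : 'I_m => i.+1.-tuple P) (sigma i)) | i < m].

Definition cofinal_fun (d : Order.disp_t) (P : preorderType d) (m : nat)
    (F : tuples_upto P m -> P) : Prop :=
  (forall (x : P) (u : tuples_upto P m),
     upto_seq u = [:: x] -> (x <= F u)%O) /\
  (forall u v : tuples_upto P m,
     subseq (upto_seq u) (upto_seq v) -> (F u <= F v)%O).

(* The cardinal lambda enters only as a set of colours L. The formula makes
   sense for every quasi-order; directedness, which holds automatically for
   ordinals, is not used in it. *)
Definition PH (n : nat) (d : Order.disp_t) (P : preorderType d) (L : Type)
    : Prop :=
  forall c : n.+1.-tuple P -> L,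
    exists F : tuples_upto P n.+1 -> P,
      cofinal_fun F /\
      exists k : L, forall sigma : tuple_chain P n.+1, c (star F sigma) = k.

(* [has_type_omega n T]: T is a well-order of order type omega_n. Here omega_0
   is the least infinite ordinal, and omega_{n+1} is the least ordinal which
   does not inject into omega_n; the elements of an ordinal are identified with
   its proper initial segments. *)
Fixpoint has_type_omega (n : nat) (d : Order.disp_t) (T : orderType d) : Prop :=
  well_order (<=%O : rel T) /\
  match n with
  | 0 => infinite_set [set: T] /\
         forall x : T, finite_set [set y : T | (y < x)%O]
  | m.+1 => exists (d' : Order.disp_t) (S : orderType d'),
         has_type_omega m S /\
         ~ ([set: T] #<= [set: S])%card /\
         forall x : T, ([set y : T | (y < x)%O] #<= [set: S])%card
  end.

(* Main.v *)
Require Import Defs.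
From mathcomp Require Import finmap all_boot all_order.
From HB Require Import structures.
From mathcomp Require Import boolp classical_sets functions cardinality.

(** A set X of size at most aleph_n carries a map g from X^(n+1) to
    {0, ..., n} x omega such that g(x) = (j, k) and k together determine the
    coordinate x_j from the other coordinates (a form of Kuratowski's theorem).
    If g o F^* were constant with value (j, k), then F(sigma(j)) would be
    determined by the values of F at the other members of the chain sigma.
    Taking chains made of copies of a fixed point t, into which a point q is
    inserted either at step j or at step j + 1, gives
    q <= F(t, ..., t, q) = F(t, ..., t): the right-hand side would bound P. *)

Set Implicit Arguments.
Unset Strict Implicit.
Unset Printing Implicit Defensive.

Import Order.TTheory.
Local Open Scope classical_set_scope.

Lemma card_leTP (T : Type) (U : choiceType) (u : U) (A : set T) :
  (A #<= [set: U])%card <-> exists f : T -> U, {in A &, injective f}.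
Proof.
pose P : pointedType := HB.pack U (isPointed.Build U u).
by split=> [/(@pcard_injP T P)|?]; last exact/(@pcard_injP T P).
Qed.

(** Hilbert's hotel: [s] moves each point of an embedded copy [h] of the naturals to the next one
    and fixes all other points, which frees [h 0]. *)
Lemma infinite_set_shift (U : choiceType) : infinite_set [set: U] ->
  exists (u : U) (s : U -> U), injective s /\ forall v, s v <> u.
Proof.
move=> Uinf; have [u _] := infinite_setN0 Uinf.
move/infiniteP/(card_leTP u) : Uinf => [h /in2TT hI].
pose s v := if pselect (exists k, h k = v) is left e then h (projT1 (cid e)).+1
            else v.
exists (h 0), s; split=> [v w|v]; rewrite /s.
- case: pselect => [e|ne]; case: pselect => [e'|ne'] //.
  + by case: cid => k hk; case: cid => l hl /= /hI[kl]; rewrite -hk -hl kl.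
  + by move=> ew; case: ne'; eexists; exact: ew.
  + by move=> ev; case: ne; eexists; exact: esym ev.
- case: pselect => [e /hI //|ne ev]; by case: ne; exists 0.
Qed.

Lemma card_le_setU1 (T : Type) (U : choiceType) (A : set T) (b : T) :
  infinite_set [set: U] -> (A #<= [set: U])%card ->
  (A `|` [set b] #<= [set: U])%card.
Proof.
move=> Uinf; have [u [s [sI su]]] := infinite_set_shift Uinf.
move=> /(card_leTP u)[f fI]; apply/(card_leTP u).
exists (fun x => if pselect (A x) is left _ then s (f x) else u) => x y.
rewrite !inE /= => Ax Ay; case: pselect => xA; case: pselect => yA.
- by move=> /sI /fI; rewrite !inE; apply.
- by move/su.
- by move/esym/su.
- by case: Ax Ay => // -> [].
Qed.

Lemma type_omega_infinite n d (T : orderType d) :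
  has_type_omega n T -> infinite_set [set: T].
Proof.
elim: n d T => [|n IH] d T /= [_]; first by case.
move=> [d' [S [/IH/infiniteP Sinf [nTS _]]]] /finite_set_countable cT.
exact/nTS/(card_le_trans cT).
Qed.

Lemma segmentS d (T : orderType d) (b : T) :
  [set y | (y <= b)%O] = [set y | (y < b)%O] `|` [set b].
Proof.
apply/seteqP; split=> y /=.
  by rewrite le_eqVlt => /orP[/eqP|]; [right|left].
by case=> [/ltW|->].
Qed.

(** A maximum [b] would make [T] a proper initial segment plus one point, hence finite, or no larger
    than [S]. *)
Lemma type_omega_unbounded n d (T : orderType d) (b : T) :
  has_type_omega n T -> ~ forall x : T, (x <= b)%O.
Proof.
move=> hT bmax; have Tb : [set: T] = [set y | (y < b)%O] `|` [set b].
  by rewrite -segmentS; apply/seteqP; split=> x _ /=.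
case: n hT => [|n] /= [_].
  by rewrite Tb => -[Tinf /(_ b) bfin]; apply: Tinf; rewrite finite_setU; split.
move=> [d' [S [/type_omega_infinite Sinf [nTS /(_ b) bS]]]]; apply: nTS.
by rewrite Tb; exact: card_le_setU1.
Qed.

Definition coordinate_coloring (n : nat) (X : Type)
    (g : ('I_n.+1 -> X) -> 'I_n.+1 * nat) : Prop :=
  forall x y, g x = g y -> (forall i, i != (g x).1 -> x i = y i) ->
  x (g x).1 = y (g x).1.

(** The number of predecessors is strictly increasing, so it determines the only coordinate. *)
Lemma coordinate_coloring0 d (T : orderType d) :
  (forall x : T, finite_set [set y : T | (y < x)%O]) ->
  exists g, @coordinate_coloring 0 T g.
Proof.
move=> Tfin; pose rk (x : T) := #|` fset_set [set y : T | (y < x)%O]|%fset.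
have rk_lt x y : (x < y)%O -> rk x < rk y.
  move=> xy; rewrite /rk; apply: fproper_ltn_card; rewrite fproperE.
  apply/andP; split.
    by apply/fsubsetP => z; rewrite !in_fset_set// !inE /= => /lt_trans; apply.
  apply/negP => /fsubsetP/(_ x).
  by rewrite !in_fset_set// !inE /= ltxx xy => /(_ isT).
exists (fun x => (ord0, rk (x ord0))) => x y /= [rkE] _.
by case: (ltgtP (x ord0) (y ord0)) => // /rk_lt; rewrite rkE ltnn.
Qed.

(* The maximal coordinate m of the tuple embeds all the others into S by [e m],
   so that they can be coloured by g; the position of m is part of the colour. *)
Lemma coordinate_coloringS n d (T : orderType d) (S : Type)
    (e : T -> T -> S) g :
  (forall b x y, (x <= b)%O -> (y <= b)%O -> e b x = e b y -> x = y) ->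
  @coordinate_coloring n S g -> exists g', @coordinate_coloring n.+1 T g'.
Proof.
move=> eI gP.
pose top (x : 'I_n.+2 -> T) : 'I_n.+2 := [arg max_(i > ord0) x i]%O.
have topP x i : (x i <= x (top x))%O.
  by rewrite /top; case: arg_maxP => // j _; apply.
pose rest x (k : 'I_n.+1) := e (x (top x)) (x (lift (top x) k)).
exists (fun x => (lift (top x) (g (rest x)).1,
                  pickle (top x, (g (rest x)).1, (g (rest x)).2))) => x y /=.
case=> _ /(pcan_inj pickleK)[topE g1E g2E] xy.
have gE : g (rest x) = g (rest y).
  by rewrite [LHS]surjective_pairing g1E g2E -surjective_pairing.
(* The coordinate to be recovered is never the top one, so [x] and [y] share their maximum, and the
   same embedding is applied to both. *)
have mE : x (top x) = y (top x) by apply: xy; rewrite neq_lift.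
have restE k : rest y k = e (x (top x)) (y (lift (top x) k)).
  by rewrite /rest -topE -mE.
apply: (eI (x (top x))); rewrite ?topP//; first by rewrite mE topE topP.
have := gP _ _ gE; rewrite restE; apply=> k kj.
by rewrite restE /rest; congr (e _ _); apply: xy; rewrite (inj_eq lift_inj).
Qed.

Lemma type_omega_coordinate_coloring n d (T : orderType d) :
  has_type_omega n T -> exists g, @coordinate_coloring n T g.
Proof.
elim: n d T => [|n IH] d T /= [_].
  by case=> _ Tfin; exact: coordinate_coloring0.
move=> [d' [S [hS [_ segS]]]]; have [g gP] := IH _ _ hS.
have Sinf := type_omega_infinite hS; have [s _] := infinite_setN0 Sinf.
have /choice[e eI] (b : T) :
    exists f : T -> S, {in [set y | (y <= b)%O] &, injective f}.
  by apply/(card_leTP s); rewrite segmentS; exact: card_le_setU1.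
apply: (coordinate_coloringS (e := e)) gP => b x y xb yb.
by apply: eI; rewrite inE.
Qed.

Section ThresholdChain.
Variables (d : Order.disp_t) (T : orderType d) (n : nat) (t q : T).

Definition const_tuple i : i.+1.-tuple T := [tuple of nseq i.+1 t].
Definition end_tuple i : i.+1.-tuple T :=
  [tuple of rcons [tuple of nseq i t] q].

(** Thresholds [h] and [h.+1] give chains that differ at step [h] only. *)
Definition threshold_fun h (i : 'I_n) : i.+1.-tuple T :=
  if i < h then const_tuple i else end_tuple i.

Lemma threshold_subseq h (i j : 'I_n) :
  j = i.+1 :> nat -> subseq (threshold_fun h i) (threshold_fun h j).
Proof.
rewrite /threshold_fun => ->; case: (ltnP i h) => ih.
  case: ifP => _; first exact: subseq_cons.
  exact: subseq_rcons.
rewrite ltnNge (leqW ih) /=; exact: subseq_cons.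
Qed.

Definition threshold_chain h : tuple_chain T n :=
  TupleChain (@threshold_subseq h).

End ThresholdChain.

Theorem theorem8p6 (n : nat) (d : Order.disp_t) (T : orderType d)
    (hT : has_type_omega n T) : ~ PH n T nat.
Proof.
have [g gP] := type_omega_coordinate_coloring hT.
move=> /(_ (fun x => pickle (g (tnth x))))[F [[Fx Fmono] [k Fk]]].
have [t _] := infinite_setN0 (type_omega_infinite hT).
pose X s := tnth (star F s).
have gX s s' : g (X s) = g (X s').
  by apply: (pcan_inj pickleK); rewrite /X !Fk.
(* Any chain would do here: the value of [g] is the same for all of them. *)
pose j := (g (X (threshold_chain n.+1 t t 0))).1.
have gj s : (g (X s)).1 = j by rewrite /j (gX s (threshold_chain n.+1 t t 0)).
pose at_j (u : j.+1.-tuple T) : tuples_upto T n.+1 :=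
  Tagged (fun i : 'I_n.+1 => i.+1.-tuple T) u.
apply: (type_omega_unbounded (b := F (at_j (const_tuple t j))) hT) => q.
have : X (threshold_chain n.+1 t q j.+1) j = X (threshold_chain n.+1 t q j) j.
  have := gP _ _ (gX (threshold_chain _ t q j.+1) (threshold_chain _ t q j)).
  rewrite gj; apply=> i ij; rewrite /X /star !tnth_mktuple /= /threshold_fun.
  by rewrite ltnS leq_eqVlt (negPf (ij : i != j :> nat)).
rewrite /X /star !tnth_mktuple /= /threshold_fun ltnSn ltnn => ->.
pose u : tuples_upto T n.+1 :=
  Tagged (fun i : 'I_n.+1 => i.+1.-tuple T) (i := ord0) [tuple q].
(* The bound is now [F] of the tuple ending in [q], which contains the singleton [u] as a suffix. *)
apply: (le_trans (Fx q u erefl)); apply: (Fmono u (at_j (end_tuple t q j))).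
by rewrite /upto_seq /= -cats1 suffix_subseq.
Qed.
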